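(* Let $T>0$ and let $H:[0,T]\times\mathbb{R}\times\mathbb{R}\to\mathbb{R}$ be the Hamiltonian defined in the context. Then $H$ is locally Lipschitz continuous, i.e. for each $(t_0,x_0,p_0)\in[0,T]\times\mathbb{R}\times\mathbb{R}$ there exist numbers $r,k>0$ such that for all $t,s\in[0,T]$ with $|t-t_0|\le r$, $|s-t_0|\le r$, all $x,y\in\mathbb{R}$ with $|x-x_0|\le r$, $|y-x_0|\le r$, and all $p,q\in\mathbb{R}$ with $|p-p_0|\le r$, $|q-p_0|\le r$, $$|H(t,x,p)-H(s,y,q)|\le k\,(|t-s|+|x-y|+|p-q|).$$
   Context: Define $\varphi:[0,T]\times\mathbb{R}\to\mathbb{R}$ by $\varphi(t,x)=\sqrt{|t-x|}\,\exp\!\big(2\sqrt{|t-x|}\big)$. The Hamiltonian $H:[0,T]\times\mathbb{R}\times\mathbb{R}\to\mathbb{R}$ is $$H(t,x,p)=\begin{cases}0 & \text{if } t\ne x,\ 2|p|\le \frac{1}{\varphi(t,x)},\\[1mm] 2|p|-\frac{1}{\varphi(t,x)} & \text{if } t\neq x,\ 2|p|>\frac{1}{\varphi(t,x)},\\[1mm] 0 & \text{if } t=x,\ p\in\mathbb{R}.\end{cases}$$ *)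

(* Defs.v *)
From Stdlib Require Import Reals Lra.
Open Scope R_scope.

(* The formulas do not involve the horizon T, so phi and Ham are defined for
   every real time; statements restrict the time variables to [0, T]. *)
Definition phi (t x : R) : R :=
  sqrt (Rabs (t - x)) * exp (2 * sqrt (Rabs (t - x))).

Definition Ham (t x p : R) : R :=
  if Req_dec_T t x then 0
  else if Rle_dec (2 * Rabs p) (1 / phi t x) then 0
  else 2 * Rabs p - 1 / phi t x.

(* Main.v *)
Require Import Defs.
From Stdlib Require Import Reals Lra.
Open Scope R_scope.

(** Off the diagonal, the Hamiltonian is the positive part of
    [2 * Rabs p - 1 / phi t x], and [1 / phi t x] is a decreasing function
    [slope] of the root [a = sqrt (Rabs (t - x))].  The only possible failure of
    the Lipschitz property is at the diagonal, where [1 / phi] blows up; but this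
    blow-up is also the remedy, since for bounded [p] it forces the positive part
    to vanish near the diagonal.  Quantitatively, if [2 * Rabs p <= slope alpha],
    then replacing [a] by [Rmax alpha a] does not change the Hamiltonian, and the
    formula so obtained covers the diagonal as well ([Ham_eq_clipped]).

    Every ingredient of the clipped formula is Lipschitz: [slope] on the half-line
    from [alpha] on ([slope_lipschitz]), the clipped square root on the whole
    half-line ([clipped_sqrt_lipschitz]), and the positive part.  Since [slope]
    tends to infinity at [0], an [alpha] exists for each bound on [p]
    ([slope_large]).  Hence the Lipschitz constant depends only on the bound on
    [p]. *)

(** [1 / phi t x] as a function of [sqrt (Rabs (t - x))]. *)
Definition slope (a : R) : R := 1 / (a * exp (2 * a)).

Lemma slope_split (a : R) : 0 < a -> slope a = exp (- (2 * a)) * / a.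
Proof.
  intros Ha. unfold slope. rewrite exp_Ropp.
  pose proof (exp_pos (2 * a)). field. lra.
Qed.

Lemma slope_decreasing (a b : R) : 0 < a -> a <= b -> slope b <= slope a.
Proof.
  intros Ha Hab. rewrite !slope_split by lra.
  apply Rmult_le_compat.
  - left; apply exp_pos.
  - left; apply Rinv_0_lt_compat; lra.
  - destruct Hab as [Hab | ->]; [left; apply exp_increasing; lra | lra].
  - apply Rinv_le_contravar; lra.
Qed.

(** The two factors of [slope a = exp (- 2 a) / a] vary separately: the
    exponential is [2]-Lipschitz and at most [1] on the positive half-line, while
    the inverse is [/ alpha ^ 2]-Lipschitz and at most [/ alpha] beyond [alpha]. *)
Lemma slope_lipschitz_ordered (alpha a b : R) :
  0 < alpha -> alpha <= a -> a <= b ->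
  slope a - slope b <= (/ alpha * / alpha + 2 * / alpha) * (b - a).
Proof.
  intros Hal Ha Hab. rewrite !slope_split by lra.
  set (ea := exp (- (2 * a))). set (eb := exp (- (2 * b))).
  assert (Hea : 0 < ea) by apply exp_pos.
  assert (Hea1 : ea <= 1).
  { unfold ea. rewrite <- exp_0. left. apply exp_increasing. lra. }
  assert (Heb : ea - eb <= 2 * (b - a)).
  { assert (E : eb = ea * exp (- (2 * (b - a)))).
    { unfold ea, eb. rewrite <- exp_plus. f_equal. ring. }
    pose proof (exp_ineq1_le (- (2 * (b - a)))). rewrite E. nra. }
  assert (Hia : / a <= / alpha) by (apply Rinv_le_contravar; lra).
  assert (Hib : / b <= / alpha) by (apply Rinv_le_contravar; lra).
  assert (Pa : 0 < / a) by (apply Rinv_0_lt_compat; lra).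
  assert (Pb : 0 < / b) by (apply Rinv_0_lt_compat; lra).
  assert (Hinv : / a - / b = (b - a) * (/ a * / b)) by (field; lra).
  assert (Hprod : / a * / b <= / alpha * / alpha)
    by (apply Rmult_le_compat; lra).
  assert (P : 0 < / a * / b) by (apply Rmult_lt_0_compat; lra).
  replace (ea * / a - eb * / b) with (ea * (/ a - / b) + (ea - eb) * / b)
    by ring.
  assert (H1 : ea * (/ a - / b) <= 1 * ((b - a) * (/ alpha * / alpha))).
  { rewrite Hinv. apply Rmult_le_compat; try lra.
    - apply Rmult_le_pos; lra.
    - apply Rmult_le_compat_l; lra. }
  assert (H2 : (ea - eb) * / b <= 2 * (b - a) * / alpha).
  { apply Rle_trans with (2 * (b - a) * / b).
    - apply Rmult_le_compat_r; lra.
    - apply Rmult_le_compat_l; lra. }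
  lra.
Qed.

Lemma slope_lipschitz (alpha a b : R) :
  0 < alpha -> alpha <= a -> alpha <= b ->
  Rabs (slope a - slope b)
    <= (/ alpha * / alpha + 2 * / alpha) * Rabs (a - b).
Proof.
  intros Hal Ha Hb. destruct (Rle_dec a b) as [Hab | Hab].
  - rewrite Rabs_pos_eq, Rabs_left1, Ropp_minus_distr; try lra.
    + now apply slope_lipschitz_ordered.
    + pose proof (slope_decreasing a b). lra.
  - rewrite Rabs_left1, (Rabs_pos_eq (a - b)), Ropp_minus_distr; try lra.
    + apply slope_lipschitz_ordered; lra.
    + pose proof (slope_decreasing b a). lra.
Qed.

(** From [sqrt e - sqrt d = (e - d) / (sqrt e + sqrt d)]: when the clipped values
    differ, the denominator exceeds [alpha]. *)
Lemma clipped_sqrt_lipschitz (alpha d e : R) :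
  0 < alpha -> 0 <= d -> 0 <= e ->
  Rabs (Rmax alpha (sqrt d) - Rmax alpha (sqrt e)) <= / alpha * Rabs (d - e).
Proof.
  intros Hal Hd He.
  apply Rmult_le_reg_l with alpha; [lra |].
  rewrite <- Rmult_assoc, Rinv_r, Rmult_1_l by lra.
  pose proof (sqrt_sqrt d Hd) as Sd. pose proof (sqrt_sqrt e He) as Se.
  pose proof (sqrt_pos d). pose proof (sqrt_pos e).
  set (a := sqrt d) in *. set (b := sqrt e) in *. clearbody a b. subst d e.
  replace (a * a - b * b) with ((a + b) * (a - b)) by ring.
  rewrite Rabs_mult, (Rabs_pos_eq (a + b)) by lra.
  unfold Rmax. destruct (Rle_dec alpha a), (Rle_dec alpha b).
  - apply Rmult_le_compat_r; [apply Rabs_pos | lra].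
  - rewrite !Rabs_pos_eq by lra. apply Rmult_le_compat; lra.
  - rewrite !Rabs_left1 by lra. apply Rmult_le_compat; lra.
  - rewrite Rminus_diag, Rabs_R0, Rmult_0_r.
    apply Rmult_le_pos; [lra | apply Rabs_pos].
Qed.

Lemma pos_part_lipschitz (u v : R) :
  Rabs (Rmax 0 u - Rmax 0 v) <= Rabs (u - v).
Proof.
  unfold Rmax. destruct (Rle_dec 0 u), (Rle_dec 0 v);
    unfold Rabs; repeat destruct Rcase_abs; lra.
Qed.

(** Clipping acts only where [sqrt (Rabs (t - x)) < alpha].  Off the diagonal,
    [2 * Rabs p <= slope alpha <= 1 / phi t x] there, so both sides vanish; on the
    diagonal the clipped value is [alpha] itself and the right side vanishes too. *)
Lemma Ham_eq_clipped (alpha t x p : R) :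
  0 < alpha -> 2 * Rabs p <= slope alpha ->
  Ham t x p = Rmax 0 (2 * Rabs p - slope (Rmax alpha (sqrt (Rabs (t - x))))).
Proof.
  intros Hal Hp. unfold Ham.
  destruct (Req_dec_T t x) as [-> | Htx].
  - rewrite Rminus_diag, Rabs_R0, sqrt_0, (Rmax_left alpha 0) by lra.
    rewrite Rmax_left; lra.
  - assert (Ha : 0 < sqrt (Rabs (t - x)))
      by (apply sqrt_lt_R0, Rabs_pos_lt; lra).
    change (1 / phi t x) with (slope (sqrt (Rabs (t - x)))).
    set (a := sqrt (Rabs (t - x))) in *. clearbody a.
    destruct (Rle_dec alpha a) as [Hle | Hgt].
    + rewrite (Rmax_right alpha a) by lra.
      destruct (Rle_dec (2 * Rabs p) (slope a)).
      * rewrite Rmax_left; lra.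
      * rewrite Rmax_right; lra.
    + rewrite (Rmax_left alpha a) by lra.
      pose proof (slope_decreasing a alpha).
      destruct (Rle_dec (2 * Rabs p) (slope a)); [| lra].
      rewrite Rmax_left; lra.
Qed.

Lemma slope_large (M : R) : exists alpha : R, 0 < alpha /\ M <= slope alpha.
Proof.
  (* For alpha <= 1 the exponential in [slope] costs at most exp 2, so
     alpha = exp (-2) / N is small enough for any N >= M; N >= 1 ensures
     alpha <= 1. *)
  set (N := Rmax 1 M).
  assert (HN : 1 <= N) by apply Rmax_l.
  assert (HM : M <= N) by apply Rmax_r.
  assert (Hiv : / N <= 1) by (rewrite <- Rinv_1; apply Rinv_le_contravar; lra).
  assert (HiN : 0 < / N) by (apply Rinv_0_lt_compat; lra).
  assert (He : exp (-2) <= 1)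
    by (rewrite <- exp_0; left; apply exp_increasing; lra).
  pose proof (exp_pos (-2)) as Hep.
  exists (exp (-2) * / N).
  assert (Hpos : 0 < exp (-2) * / N) by (apply Rmult_lt_0_compat; lra).
  split; [exact Hpos |].
  set (alpha := exp (-2) * / N) in *.
  assert (Hle : alpha <= 1).
  { unfold alpha. rewrite <- (Rmult_1_r 1). apply Rmult_le_compat; lra. }
  assert (Hinv : / alpha = N * / exp (-2)) by (unfold alpha; field; lra).
  assert (Hexp : exp (-2) <= exp (- (2 * alpha))).
  { destruct Hle as [Hlt | ->].
    - left. apply exp_increasing. lra.
    - right. f_equal. ring. }
  apply Rle_trans with N; [exact HM |].
  rewrite slope_split by exact Hpos.
  apply Rle_trans with (exp (-2) * / alpha).
  - right. rewrite Hinv. field. lra.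
  - apply Rmult_le_compat_r; [| exact Hexp].
    left. now apply Rinv_0_lt_compat.
Qed.

(** With [slope alpha >= M] the clipped formula represents the Hamiltonian for
    all the values of [p] at once; its dependence on [t] and [x] is the composite
    of [Rabs (t - x)], the clipped root (constant [/ alpha]) and [slope]
    (constant [L]). *)
Lemma Ham_lipschitz_bounded_p (M : R) :
  exists k : R, 0 < k /\
    forall t s x y p q : R,
      2 * Rabs p <= M -> 2 * Rabs q <= M ->
      Rabs (Ham t x p - Ham s y q)
        <= k * (Rabs (t - s) + Rabs (x - y) + Rabs (p - q)).
Proof.
  destruct (slope_large M) as [alpha [Hal HM]].
  assert (Hi : 0 < / alpha) by now apply Rinv_0_lt_compat.
  set (L := / alpha * / alpha + 2 * / alpha).
  assert (HL : 0 < L) by (unfold L; nra).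
  assert (HK : 0 < L * / alpha) by now apply Rmult_lt_0_compat.
  exists (2 + L * / alpha). split; [lra |].
  intros t s x y p q Hp Hq.
  rewrite (Ham_eq_clipped alpha t x p), (Ham_eq_clipped alpha s y q) by lra.
  eapply Rle_trans; [apply pos_part_lipschitz |].
  set (a := Rmax alpha (sqrt (Rabs (t - x)))).
  set (b := Rmax alpha (sqrt (Rabs (s - y)))).
  replace (2 * Rabs p - slope a - (2 * Rabs q - slope b))
    with (2 * (Rabs p - Rabs q) + - (slope a - slope b)) by ring.
  eapply Rle_trans; [apply Rabs_triang |].
  rewrite Rabs_Ropp, Rabs_mult, (Rabs_pos_eq 2) by lra.
  assert (H1 : Rabs (slope a - slope b) <= L * Rabs (a - b))
    by (apply slope_lipschitz; [exact Hal | apply Rmax_l | apply Rmax_l]).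
  assert (H2 : Rabs (a - b) <= / alpha * Rabs (Rabs (t - x) - Rabs (s - y)))
    by (apply clipped_sqrt_lipschitz; [exact Hal | apply Rabs_pos | apply Rabs_pos]).
  assert (H3 : Rabs (Rabs (t - x) - Rabs (s - y)) <= Rabs (t - s) + Rabs (x - y)).
  { eapply Rle_trans; [apply Rabs_triang_inv2 |].
    replace (t - x - (s - y)) with ((t - s) + - (x - y)) by ring.
    rewrite <- (Rabs_Ropp (x - y)). apply Rabs_triang. }
  assert (H4 : L * Rabs (a - b) <= L * / alpha * (Rabs (t - s) + Rabs (x - y))).
  { rewrite Rmult_assoc. apply Rmult_le_compat_l; [lra |].
    eapply Rle_trans; [exact H2 |]. apply Rmult_le_compat_l; lra. }
  pose proof (Rabs_triang_inv2 p q).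
  pose proof (Rabs_pos (t - s)). pose proof (Rabs_pos (x - y)).
  assert (0 <= L * / alpha * Rabs (p - q))
    by (apply Rmult_le_pos; [lra | apply Rabs_pos]).
  lra.
Qed.

Theorem theorem3p1 (T : R) (hT : 0 < T) :
  forall t0 x0 p0 : R, 0 <= t0 <= T ->
  exists r k : R, 0 < r /\ 0 < k /\
    forall t s x y p q : R,
      0 <= t <= T -> 0 <= s <= T ->
      Rabs (t - t0) <= r -> Rabs (s - t0) <= r ->
      Rabs (x - x0) <= r -> Rabs (y - x0) <= r ->
      Rabs (p - p0) <= r -> Rabs (q - p0) <= r ->
      Rabs (Ham t x p - Ham s y q)
        <= k * (Rabs (t - s) + Rabs (x - y) + Rabs (p - q)).
Proof.
  intros t0 x0 p0 _.
  destruct (Ham_lipschitz_bounded_p (2 * (Rabs p0 + 1))) as [k [Hk Hlip]].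
  exists 1, k. split; [lra |]. split; [exact Hk |].
  intros t s x y p q _ _ _ _ _ _ Hp Hq.
  pose proof (Rabs_triang_inv p p0). pose proof (Rabs_triang_inv q p0).
  apply Hlip; lra.
Qed.
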